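(* Let $L$ be a continuous lattice. If $\upsilon(L^{op})=\sigma(L^{op})$, then $(L^{op},\sigma(L^{op}))$ is a sober and locally compact space.
   Context: $L^{op}$ is $L$ with the reversed order. For a poset $Q$: the upper topology $\upsilon(Q)$ is generated by the subbase $\{Q\setminus\mathord{\downarrow}x: x\in Q\}$, where $\mathord{\downarrow}x=\{y\in Q:y\le x\}$; the Scott topology $\sigma(Q)$ consists of the complements of those lower sets that are closed under existing suprema of directed subsets. A continuous lattice is a complete lattice that is a continuous poset. A space is sober if every irreducible closed set is the closure of a unique point. A space is locally compact if for every point $x$ and open $U\ni x$ there is a compact set $K$ with $x\in\mathrm{int}\,K\subseteq K\subseteq U$. *)

(* Defs.v *)
From HB Require Import structures.
From mathcomp Require Import all_boot all_order.
From mathcomp Require Import boolp classical_sets filter topology.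

Set Implicit Arguments.
Unset Strict Implicit.
Unset Printing Implicit Defensive.

Local Open Scope classical_set_scope.
Local Open Scope order_scope.

Section Posets.
Context {d : Order.disp_t} {Q : porderType d}.
Implicit Types (x y : Q) (D C U : set Q).

Definition directed D : Prop :=
  D !=set0 /\
  forall x y, D x -> D y -> exists z, [/\ D z, x <= z & y <= z].

Definition lower_set C : Prop := forall x y, y <= x -> C x -> C y.

Definition way_below x y : Prop :=
  forall D s, directed D -> supremums D s -> y <= s ->
    exists2 z, D z & x <= z.

Definition scott_closed C : Prop :=
  lower_set C /\
  forall D s, directed D -> D `<=` C -> supremums D s -> C s.

Definition scott_open U : Prop := scott_closed (~` U).

Lemma scott_openT : scott_open setT.
Proof.
rewrite /scott_open setCT; split=> [x y _ []|D s [[x Dx] _] DC _].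
exact: DC Dx.
Qed.

Lemma scott_openI (U V : set Q) :
  scott_open U -> scott_open V -> scott_open (U `&` V).
Proof.
move=> [lU dU] [lV dV]; rewrite /scott_open setCI; split.
  by move=> x y yx [Ux|Vx]; [left; apply: lU Ux|right; apply: lV Vx].
move=> D s [D0 dD] DUV sD.
have [DU|/existsNP[x /not_implyP[Dx nUx]]] := pselect (D `<=` ~` U).
  by left; apply: dU DU sD.
right; apply: (dV D) => // y Dy.
have [z [Dz xz yz]] := dD _ _ Dx Dy.
case: (DUV z Dz) => [Uz|Vz]; last exact: lV Vz.
by case: nUx; apply: lU Uz.
Qed.

Lemma scott_open_bigU (J : Type) (f : J -> set Q) :
  (forall i, scott_open (f i)) -> scott_open (\bigcup_i f i).
Proof.
move=> of_; rewrite /scott_open setC_bigcup; split.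
  by move=> x y yx fx i _; have [lf _] := of_ i; apply: lf yx (fx i I).
move=> D s dD Df sD i _; have [_ df] := of_ i.
by apply: df dD _ sD => x Dx; apply: Df.
Qed.

End Posets.

Definition complete_lattice {d} (L : porderType d) : Prop :=
  forall A : set L, supremums A !=set0 /\ infimums A !=set0.

Definition continuous_poset {d} (P : porderType d) : Prop :=
  forall x : P, directed (way_below^~ x) /\ supremums (way_below^~ x) x.

Definition continuous_lattice {d} (L : porderType d) : Prop :=
  complete_lattice L /\ continuous_poset L.

Definition upper_space {d} (Q : porderType d) : Type := Q.

HB.instance Definition _ {d} (Q : porderType d) := Choice.on (upper_space Q).
(* The subbase is indexed by itself: the factory wants a pointed index type,
   and [Q] may be empty. *)
HB.instance Definition _ {d} (Q : porderType d) :=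
  @isSubBaseTopological.Build (upper_space Q)
    (set Q) (range (fun x : Q => ~` [set y | y <= x])) id.

Definition scott_space {d} (Q : porderType d) : Type := Q.

HB.instance Definition _ {d} (Q : porderType d) := Choice.on (scott_space Q).
HB.instance Definition _ {d} (Q : porderType d) :=
  @isOpenTopological.Build (scott_space Q) (@scott_open d Q)
    scott_openT scott_openI scott_open_bigU.

Definition upper_topology {d} (Q : porderType d) : set (set Q) :=
  @open (upper_space Q).
Arguments upper_topology {d} Q.

Definition scott_topology {d} (Q : porderType d) : set (set Q) :=
  @open (scott_space Q).
Arguments scott_topology {d} Q.

Definition irreducible {X : topologicalType} (A : set X) : Prop :=
  A !=set0 /\
  forall B C : set X, closed B -> closed C -> A `<=` B `|` C ->
    A `<=` B \/ A `<=` C.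

Definition sober_space (X : topologicalType) : Prop :=
  forall A : set X, closed A -> irreducible A ->
    exists! x, A = closure [set x].

(* Differs from the library's [locally_compact], which only asks each point
   for one closed compact neighbourhood. *)
Definition locally_compact_space (X : topologicalType) : Prop :=
  forall (x : X) (U : set X), open U -> U x ->
    exists K : set X, [/\ compact K, K° x & K `<=` U].

(* Main.v *)
Require Import Defs.
From mathcomp Require Import all_boot all_order.
From mathcomp Require Import finmap boolp classical_sets filter topology.

(** Write [Q] for the opposite of [L].  The subbasic closed sets of the upper
topology of [Q] are the principal ideals of [Q], so every open neighbourhood of
[a] contains the complement of a union of finitely many principal ideals, none
of which contains [a] ([upper_open_finite]).  When the Scott topology of [Q] is
included in the upper topology, its open sets have the same description, and
both conclusions follow.

For sobriety ([scott_sober]), let [a] be the supremum in the complete lattice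
[Q] of an irreducible closed set [A].  If [a] were outside [A], then [A] would
be covered by finitely many principal ideals that do not contain [a];
by irreducibility one of them would contain [A], hence its supremum [a].  So
[A], being a lower set of [Q], is the principal ideal of [a], that is, the
closure of the point [a].

Local compactness rests on duality: every Scott closed set of a complete [L] is
compact in [Q] for this topology ([compact_scott_closed]).  If a neighbourhood
of [a] contains all points outside the principal filters in [L] of
[x1, ..., xn], where no [xi] is below [a], continuity of [L] gives [yi] way
below [xi] with [yi] not below [a]; the points of [L] that no [yi] is way below
form a Scott closed set, by interpolation, that lies in the given neighbourhood
and contains the complement of the principal filters of the [yi], an open
neighbourhood of [a]. *)

Import Order.TTheory.

Set Implicit Arguments.
Unset Strict Implicit.
Unset Printing Implicit Defensive.

Local Open Scope order_scope.
Local Open Scope classical_set_scope.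

Lemma irreducible_sub_bigsetU {X : topologicalType} (A : set X) (I : eqType)
    (s : seq I) (f : I -> set X) :
  irreducible A -> (forall i, closed (f i)) ->
  A `<=` \big[setU/set0]_(i <- s) f i -> exists2 i, i \in s & A `<=` f i.
Proof.
move=> [[a Aa] irrA] cf; elim: s => [|i s IHs].
  by rewrite big_nil => /(_ a Aa).
have cs : closed (\big[setU/set0]_(j <- s) f j).
  by apply: closed_bigsetU => j _; apply: cf.
rewrite big_cons => /(irrA _ _ (cf i) cs) [Ai|/IHs [j js Aj]].
  by exists i; rewrite ?mem_head.
by exists j; rewrite // in_cons js orbT.
Qed.

Section WayBelow.
Context {d : Order.disp_t} {P : porderType d}.
Implicit Types x y z : P.

Lemma supremums1_le (D : set P) s y : supremums D s -> D y -> y <= s.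
Proof. by move=> [ub _]; apply: ub. Qed.

Lemma way_belowW x y : way_below x y -> x <= y.
Proof.
move=> /(_ [set y] y); case=> //.
- by split; [exists y|move=> u v -> ->; exists y].
- by rewrite supremums1.
- by move=> z ->.
Qed.

Lemma way_below_le x y z : way_below x y -> y <= z -> way_below x z.
Proof. by move=> xy yz D s dD sD zs; apply: xy dD sD (le_trans yz zs). Qed.

(** The elements way below some element way below [y] form a directed set with
supremum [y], so the definition of [way_below x y] applies to that set. *)
Lemma way_below_interpolation x y : continuous_poset P ->
  way_below x y -> exists2 w, way_below x w & way_below w y.
Proof.
move=> contP xy.
pose D := [set u | exists2 w, way_below u w & way_below w y].
have [[[w0 w0y] dy] [uby luby]] := contP y.
have dD : directed D.
  split; first by have [[[u uw0] _] _] := contP w0; exists u, w0.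
  move=> u1 u2 [w1 u1w1 w1y] [w2 u2w2 w2y].
  have [w [wy w1w w2w]] := dy _ _ w1y w2y.
  have [[_ dw] _] := contP w.
  have [u [uw u1u u2u]] :=
    dw _ _ (way_below_le u1w1 w1w) (way_below_le u2w2 w2w).
  by exists u; split=> //; exists w.
have sD : supremums D y.
  split=> [u [w uw wy]|v ubv].
    exact: le_trans (way_belowW uw) (way_belowW wy).
  apply: luby => w wy; have [_ [_ lubw]] := contP w.
  by apply: lubw => u uw; apply: ubv; exists w.
have [z [w zw wy] xz] := xy D y dD sD (lexx y).
exists w => //; move=> E s dE sE ws.
by have [e Ee ze] := zw E s dE sE ws; exists e => //; apply: le_trans xz ze.
Qed.

(** The elements that [x] is way below form a Scott open set: if [x] is way below
a directed supremum [s], then an interpolated [w], itself way below [s], lies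
below some member of the directed set. *)
Lemma scott_closed_not_way_below x : continuous_poset P ->
  scott_closed [set z | ~ way_below x z].
Proof.
move=> contP; split=> [z w wz nxz xw|D s dD Dx sD xs].
  exact: nxz (way_below_le xw wz).
have [w xw ws] := way_below_interpolation contP xs.
have [e De we] := ws D s dD sD (lexx s).
exact: Dx De (way_below_le xw we).
Qed.

Lemma scott_closed_bigcap (I : Type) (A : set I) (f : I -> set P) :
  (forall i, A i -> scott_closed (f i)) -> scott_closed (\bigcap_(i in A) f i).
Proof.
move=> cf; split=> [x y yx fx i Ai|D s dD Df sD i Ai].
  by have [lf _] := cf i Ai; apply: lf yx (fx i Ai).
by have [_ df] := cf i Ai; apply: df dD _ sD => x Dx; apply: Df.
Qed.

End WayBelow.

Section ScottSpace.
Context {d : Order.disp_t} {Q : porderType d}.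
Implicit Types x y a : Q.

Lemma scott_closedE (C : set (scott_space Q)) :
  closed C = scott_closed (C : set Q).
Proof. by rewrite -openC /open /= /scott_open setCK. Qed.

Lemma closed_principal_ideal x : closed ([set y | y <= x] : set (scott_space Q)).
Proof.
rewrite scott_closedE; split=> [y z zy /(le_trans zy) //|D s _ Dx [_ lub]].
exact: lub.
Qed.

Lemma closure_point_scott x :
  closure ([set x] : set (scott_space Q)) = [set y | y <= x].
Proof.
apply/seteqP; split.
  rewrite closureE; apply: smallest_sub; first exact: closed_principal_ideal.
  by move=> y ->; apply: lexx.
move=> y yx.
have : closed (closure ([set x] : set (scott_space Q))) by apply: closed_closure.
by rewrite scott_closedE => -[low _]; apply: low yx _; apply: subset_closure.
Qed.

Lemma upper_open_finite (U : set Q) a : upper_topology Q U -> U a ->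
  exists2 s : {fset Q}, (forall x, x \in s -> ~ a <= x) &
    \bigcap_(x in [set` s]) ~` [set y | y <= x] `<=` U.
Proof.
move=> [B Bfin <-] [W BW Wa].
have [E Esub EW] :
    finI_from (range (fun x : Q => ~` [set y | y <= x])) id W by exact: Bfin.
(* The point [a] is a default value: it makes the choice of [h] total. *)
have /choice [h hE] (V : set Q) :
    exists x, V \in E -> V = ~` [set y | y <= x].
  have [VE|nVE] := boolP (V \in E); last by exists a.
  by have := Esub V VE; rewrite inE => -[x _ xV]; exists x.
move: Wa BW; rewrite -EW => Wa BW.
exists [fset h V | V in E]%fset.
  move=> _ /imfsetP[V /= VE ->].
  by have := Wa V VE; rewrite /= {1}(hE V VE).
move=> y sy; exists (\bigcap_(V in [set` E]) V); [exact: BW|move=> V VE].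
by rewrite /= (hE V VE); apply: sy; rewrite /= in_imfset.
Qed.

End ScottSpace.

Lemma scott_sober {d : Order.disp_t} (Q : porderType d) :
  complete_lattice Q -> scott_topology Q `<=` upper_topology Q ->
  sober_space (scott_space Q).
Proof.
move=> complQ sub A cA irrA.
have [a supA] := (complQ A).1.
have Aa : A a.
  apply: contrapT => nAa.
  have [s nleas sA] : exists2 s : {fset Q}, (forall x, x \in s -> ~ a <= x) &
      \bigcap_(x in [set` s]) ~` [set y | y <= x] `<=` ~` A.
    by apply: upper_open_finite => //; apply: sub; apply: closed_openC.
  have cover : A `<=` \big[setU/set0]_(x <- s) [set y : Q | y <= x].
    rewrite -bigcup_seq => y Ay; apply: contrapT => ny.
    by apply: (sA y) => // x xs yx; apply: ny; exists x.
  have [x xs Ax] := irreducible_sub_bigsetU irrA closed_principal_ideal cover.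
  by apply: (nleas x xs); have [_ lub] := supA; apply: lub.
have AE : A = [set y : Q | y <= a].
  apply/seteqP; split=> y; first exact: supremums1_le supA.
  by move: cA; rewrite scott_closedE => -[low _] /low; apply.
exists a; split=> [|b]; first by rewrite closure_point_scott.
rewrite closure_point_scott AE => ab; apply/le_anti/andP; split.
  by have : [set y : Q | y <= b] a by rewrite -ab /=.
by have : [set y : Q | y <= a] b by rewrite ab /=.
Qed.

Section LocalCompactness.
Context {d : Order.disp_t} {L : porderType d}.
Hypothesis complL : complete_lattice L.
Hypothesis sub : scott_topology L^d `<=` upper_topology L^d.

(** An ultrafilter [F] containing [C] converges to the supremum [s] of the
elements [z] whose principal filter belongs to [F]: these [z] form a directed
subset of [C], so [s] is in [C].  As [F] is an ultrafilter, it contains the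
complement of the principal filter of every other element, in particular of
every element not below [s]. *)
Lemma compact_scott_closed (C : set L) :
  scott_closed C -> compact (C : set (scott_space L^d)).
Proof.
move=> [lowC supC]; rewrite compact_ultra => F UF FC.
pose Z : set L := [set z | F [set y : L | z <= y]].
have [s supZ] := (complL Z).1.
exists s; split.
  apply: supC supZ.
    split.
      have [bot [_ lubb]] := (complL set0).1; exists bot.
      by apply: filterS filterT => y _; apply: lubb => ? [].
    move=> x y Zx Zy; have [j [ubj lubj]] := (complL [set x; y]).1.
    exists j; split; [|by apply: ubj; left|by apply: ubj; right].
    apply: filterS (filterI Zx Zy) => z [/= xz yz].
    by apply: lubj => _ [->|->].
  move=> z Zz; have [y [/= zy Cy]] := filter_ex (filterI Zz FC).
  exact: lowC zy Cy.
move=> V; rewrite nbhsE => -[U [oU Us] /filterS]; apply.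
have [t nlest tU] := upper_open_finite (sub oU) Us.
apply: (filterS tU); apply: filter_bigI => x xt.
have [Fx|//] := in_ultra_setVsetC [set y : L^d | y <= x] UF.
by case: (nlest x xt); apply: (supremums1_le supZ).
Qed.

Lemma scott_dual_locally_compact :
  continuous_poset L -> locally_compact_space (scott_space L^d).
Proof.
move=> contL a U oU Ua.
have [t nleat tU] := upper_open_finite (sub oU) Ua.
(* If every element way below [x] were below [a], then [x], their supremum,
   would be below [a]. *)
have /choice [f fP] (x : L) :
    exists y : L, x \in t -> way_below y x /\ ~ y <= a.
  have [xt|] := boolP (x \in t); last by exists x.
  have [//|nx] := pselect (exists y : L, way_below y x /\ ~ y <= a).
    by move=> [y yP]; exists y.
  case: (nleat x xt); have [_ [_ lub]] := contL x; apply: lub => y yx.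
  by apply: contrapT => nya; apply: nx; exists y.
pose K : set L := \bigcap_(x in [set` t]) [set z | ~ way_below (f x) z].
exists K; split.
- apply: compact_scott_closed; apply: scott_closed_bigcap => x _.
  exact: scott_closed_not_way_below.
- have : nbhs (a : scott_space L^d)
      (\bigcap_(x in [set` t]) ~` [set y : L | f x <= y]).
    apply: filter_bigI => x xt; apply: open_nbhs_nbhs.
    split; last by have [] := fP x xt.
    have oCf := closed_openC (@closed_principal_ideal _ L^d (f x)).
    exact: oCf.
  by apply: filterS => y ny x xt /way_belowW; apply: ny.
- move=> y Ky; apply: tU => x xt xy; apply: (Ky x xt).
  by have [fx _] := fP x xt; apply: way_below_le fx xy.
Qed.

End LocalCompactness.

Lemma complete_lattice_dual {d : Order.disp_t} (L : porderType d) :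
  complete_lattice L -> complete_lattice L^d.
Proof. by move=> complL A; have [supA infA] := complL A; split. Qed.

Theorem proposition3p4 (d : Order.disp_t) (L : porderType d) :
  continuous_lattice L ->
  upper_topology L^d = scott_topology L^d ->
  sober_space (scott_space L^d) /\ locally_compact_space (scott_space L^d).
Proof.
move=> [complL contL] topE.
have sub : scott_topology L^d `<=` upper_topology L^d by rewrite topE.
split; first exact: scott_sober (complete_lattice_dual complL) sub.
exact: scott_dual_locally_compact.
Qed.
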